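(* Let $(u,v)$ be a symmetric $\mathcal{T}_\mu$-coherent pair of positive measures, with corresponding sequences of monic orthogonal polynomials $\{P_n\}_{n\ge 0}$ (for $u$) and $\{R_n\}_{n\ge 0}$ (for $v$), and let $\{\sigma_n\}_{n\ge 1}$ be the coherence sequence, i.e. the sequence of non-zero numbers such that $$R_n(x)=\frac{\mathcal{T}_\mu P_{n+1}(x)}{\mu_{n+1}}-\sigma_{n-1}\frac{\mathcal{T}_\mu P_{n-1}(x)}{\mu_{n-1}},\qquad n\ge 2.$$ Put $\varepsilon_{n}=-\sigma_{n+1}$ for $n\ge 0$. Let $\lambda>0$ and let $\{S_n^{(\lambda,\mu)}\}_{n\ge 0}$ be the sequence of monic Dunkl-Sobolev orthogonal polynomials, that is, the monic polynomials orthogonal with respect to $$\langle p,q\rangle_{s,\mu}=\langle u,pq\rangle+\lambda\langle v,\mathcal{T}_\mu p\,\mathcal{T}_\mu q\rangle .$$ Then for all $n\ge 2$ $$P_{n+1}(x)+a_{n-2}P_{n-1}(x)=S_{n+1}^{(\lambda,\mu)}(x)+\eta_{n-2}^{\mu}(\lambda)\,S_{n-1}^{(\lambda,\mu)}(x),$$ $$\mu_{n+1}R_n(x)=\mathcal{T}_\mu S_{n+1}^{(\lambda,\mu)}(x)+\eta_{n-2}^{\mu}(\lambda)\,\mathcal{T}_\mu S_{n-1}^{(\lambda,\mu)}(x),$$ where $$a_{n-2}=\frac{\mu_{n+1}}{\mu_{n-1}}\,\varepsilon_{n-2},\qquad \eta_{n-2}^{\mu}(\lambda)=\frac{p_{n-1}}{s_{n-1}^{(\lambda,\mu)}}\,a_{n-2},\qquad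 n\ge 2,$$ with $p_n=\langle u,P_n^2\rangle$ and $s_n^{(\lambda,\mu)}=\langle S_n^{(\lambda,\mu)},S_n^{(\lambda,\mu)}\rangle_{s,\mu}$.
   Context: Let $\mu$ be a real number with $\mu\ne -n-\tfrac12$ for all integers $n\ge 0$. The Dunkl operator is $\mathcal{T}_\mu f(x)=f'(x)+2\mu\,\dfrac{f(x)-f(-x)}{2x}$. Put $\mu_n=n+\mu(1-(-1)^n)$, so $\mu_{2n}=2n$ and $\mu_{2n-1}=2n-1+2\mu$; then $\mathcal{T}_\mu x^n=\mu_n x^{n-1}$. A positive measure $u$ on the real line (with finite moments and infinite support) is identified with the linear form $\langle u,f\rangle=\int f\,du$ and is taken normalized, $\langle u,1\rangle=1$. It is symmetric if its support is symmetric and all its odd moments vanish. The sequence of monic orthogonal polynomials (MOPS) of $u$ is the sequence of monic polynomials $P_n$ of degree $n$ with $\langle u,P_nP_m\rangle=0$ for $n\ne m$. A pair $(u,v)$ of symmetric measures with MOPS $\{P_n\}$ and $\{R_n\}$ respectively is a symmetric $\mathcal{T}_\mu$-coherent pair if there is a sequence of non-zero complex numbers $\{\sigma_n\}_{n\ge1}$ such that $R_n=\frac{\mathcal{T}_\mu P_{n+1}}{\mu_{n+1}}-\sigma_{n-1}\frac{\mathcal{T}_\mu P_{n-1}}{\mu_{n-1}}$ for all $n\ge 2$. *)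

(* Defs.v *)
From HB Require Import structures.
From mathcomp Require Import all_boot all_order all_algebra.
From mathcomp Require Import complex.
From mathcomp Require Import all_classical all_reals all_analysis.
Set Implicit Arguments.
Unset Strict Implicit.
Unset Printing Implicit Defensive.

Import Order.TTheory GRing.Theory Num.Theory.
Import numFieldNormedType.Exports.

Local Open Scope classical_set_scope.
Local Open Scope ring_scope.
Local Open Scope complex_scope.

(* Polynomials have complex coefficients, and every form below is bilinear,
   not sesquilinear. *)

Definition dunkl_number (R : realType) (mu : R) (n : nat) : R :=
  n%:R + mu * (1 - (-1) ^+ n).

(* The division by 2X is exact, the numerator being an odd polynomial. *)
Definition dunkl (R : realType) (mu : R) (p : {poly R[i]}) : {poly R[i]} :=
  p^`() + (2 * mu)%:C *: ((p - (p \Po (- 'X))) %/ (2 *: 'X)).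

Definition msupport (R : realType) (u : set (measurableTypeR R) -> \bar R) :
    set R :=
  [set x | forall U : set R, open U -> U x -> (0 < u U)%E].

Definition moment (R : realType)
    (u : {measure set (measurableTypeR R) -> \bar R}) (n : nat) : R :=
  \int[u]_(x in setT) ((x : R) ^+ n).

Definition admissible_measure (R : realType)
    (u : {measure set (measurableTypeR R) -> \bar R}) : Prop :=
  [/\ u setT = 1%E,
      forall n : nat,
        u.-integrable setT (fun x : measurableTypeR R => ((x : R) ^+ n)%:E)
    & infinite_set (msupport u)].

Definition symmetric_measure (R : realType)
    (u : {measure set (measurableTypeR R) -> \bar R}) : Prop :=
  [/\ admissible_measure u,
      forall x : R, msupport u x -> msupport u (- x)
    & forall n : nat, moment u n.*2.+1 = 0].

Definition lform (R : realType)
    (u : {measure set (measurableTypeR R) -> \bar R}) (f : {poly R[i]}) : R[i] :=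
  (\int[u]_(x in setT) complex.Re f.[(x : R)%:C])
  +i* (\int[u]_(x in setT) complex.Im f.[(x : R)%:C]).

Definition monic_orthogonal (R : realType)
    (B : {poly R[i]} -> {poly R[i]} -> R[i]) (P : nat -> {poly R[i]}) : Prop :=
  (forall n : nat, P n \is monic /\ size (P n) = n.+1) /\
  (forall n m : nat, n <> m -> B (P n) (P m) = 0).

Definition mops (R : realType)
    (u : {measure set (measurableTypeR R) -> \bar R})
    (P : nat -> {poly R[i]}) : Prop :=
  monic_orthogonal (fun p q => lform u (p * q)) P.

Definition dunkl_coherent_pair (R : realType) (mu : R)
    (u v : {measure set (measurableTypeR R) -> \bar R})
    (P Q : nat -> {poly R[i]}) (sigma : nat -> R[i]) : Prop :=
  [/\ symmetric_measure u /\ mops u P,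
      symmetric_measure v /\ mops v Q,
      forall n : nat, (1 <= n)%N -> sigma n <> 0
    & forall n : nat, (2 <= n)%N ->
        Q n = (dunkl_number mu n.+1)%:C^-1 *: dunkl mu (P n.+1)
              - sigma n.-1 *:
                ((dunkl_number mu n.-1)%:C^-1 *: dunkl mu (P n.-1))].

Definition dunkl_sobolev (R : realType) (mu lambda : R)
    (u v : {measure set (measurableTypeR R) -> \bar R})
    (p q : {poly R[i]}) : R[i] :=
  lform u (p * q) + lambda%:C * lform v (dunkl mu p * dunkl mu q).

Lemma dunkl_Xn (R : realType) (mu : R) (n : nat) :
  dunkl mu 'X^n = (dunkl_number mu n)%:C *: 'X^(n.-1).
Proof.
have cD (x y : R) : (x + y)%:C = x%:C + y%:C by exact: raddfD.
have cn (k : nat) : (k%:R : R)%:C = k%:R by exact: rmorph_nat.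
have X2 : (2 : R[i]) *: 'X != 0 :> {poly R[i]}.
  by rewrite scaler_eq0 negb_or polyX_eq0 pnatr_eq0.
rewrite /dunkl /dunkl_number derivXn comp_Xn_poly (exprNn 'X) cD cn.
rewrite [in RHS]scalerDl [in RHS]scaler_nat; congr (_ + _).
rewrite -signr_odd -[in RHS]signr_odd.
case: n => [|n].
  by rewrite !expr0 mul1r !subrr div0p mulr0 scaler0 scale0r.
case: (odd n.+1) => /=; last by rewrite !expr0 mul1r !subrr div0p mulr0 scaler0 scale0r.
rewrite !expr1 mulN1r !opprK.
have -> : 'X^(n.+1) + 'X^(n.+1) = 'X^n * (2 *: 'X) :> {poly R[i]}.
  by rewrite -scalerAr -exprSr scaler_nat mulr2n.
by rewrite mulpK // mulrC.
Qed.

(* Main.v *)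
Require Import Defs.
From HB Require Import structures.
From mathcomp Require Import all_boot all_order all_algebra.
From mathcomp Require Import complex.
From mathcomp Require Import zify lra.
From mathcomp Require Import all_classical all_reals all_analysis.
Set Implicit Arguments.
Unset Strict Implicit.
Unset Printing Implicit Defensive.

Import Order.TTheory GRing.Theory Num.Theory.
Import numFieldNormedType.Exports.

Local Open Scope classical_set_scope.
Local Open Scope ring_scope.
Local Open Scope complex_scope.

(* Put F = P_{n+1} + a_{n-2} P_{n-1}.  Coherence says T_mu F = mu_{n+1} R_n, so
   for k <= n the v-part of <F, S_k> vanishes (T_mu S_k has degree k - 1 < n)
   and <F, S_k> = a_{n-2} <u, P_{n-1} S_k>.  This is 0 for k < n - 1 by degree,
   0 for k = n by parity, and a_{n-2} p_{n-1} for k = n - 1; so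
   F - S_{n+1} - eta_{n-2} S_{n-1}, of degree at most n, is orthogonal to
   S_0, ..., S_n, hence zero.  Applying T_mu gives the second identity.
   The forms are bilinear over the complex numbers, so positivity is used as
   B(p, conj p) > 0 for p <> 0; this gives s_n <> 0 without first proving that
   the S_n have real coefficients. *)

(** * Monic bases and the reflection of the variable *)

Lemma scalar_span_eq0 (F : nzRingType) (P : nat -> {poly F})
    (L : {poly F} -> F) (N : nat) (q : {poly F}) :
  scalar L -> (forall n, P n \is monic /\ size (P n) = n.+1) ->
  (forall k, (k < N)%N -> L (P k) = 0) -> (size q <= N)%N -> L q = 0.
Proof.
move=> Llin monP; have L0 : L 0 = 0.
  by have := Llin (-1) 0 0; rewrite scaler0 addr0 mulN1r addNr.
elim: N q => [|N IHN] q LP sq.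
  by have -> : q = 0 by apply/eqP; rewrite -size_poly_eq0 -leqn0.
have [/monicP monPN sPN] := monP N.
(* As [P N] is monic of degree [N], subtracting this multiple kills the top coefficient of [q], and
   the induction hypothesis takes the rest. *)
have -> : q = q`_N *: P N + (q - q`_N *: P N) by rewrite addrC subrK.
rewrite Llin LP // mulr0 add0r IHN // => [k kN|].
  by apply: LP; apply: leqW.
apply/leq_sizeP => j; rewrite leq_eqVlt coefB coefZ => /orP[/eqP <-|Nj].
  by move: monPN; rewrite lead_coefE sPN => ->; rewrite mulr1 subrr.
by rewrite nth_default ?[(P N)`_j]nth_default ?sPN ?(leq_trans sq) // mulr0 subrr.
Qed.

Lemma size_monicB (F : nzRingType) (p q : {poly F}) (n : nat) :
  p \is monic /\ size p = n.+1 -> q \is monic /\ size q = n.+1 ->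
  (size (p - q)%R <= n)%N.
Proof.
move=> [/monicP pmon sp] [/monicP qmon sq].
rewrite !lead_coefE sp sq /= in pmon qmon.
apply/leq_sizeP => j; rewrite leq_eqVlt coefB => /orP[/eqP <-|nj].
  by rewrite pmon qmon subrr.
by rewrite !nth_default ?subrr ?sp ?sq.
Qed.

Lemma coef_comp_polyNX (F : comNzRingType) (p : {poly F}) (i : nat) :
  (p \Po (- 'X))`_i = (-1) ^+ i * p`_i.
Proof.
have coefNXn j : ((- 'X : {poly F}) ^+ j)`_i = (-1) ^+ j * (i == j)%:R.
  rewrite (exprNn 'X) -signr_odd -[in RHS]signr_odd.
  by case: odd; rewrite ?expr0 ?expr1 !(mulN1r, mul1r) ?coefN coefXn.
rewrite coef_comp_poly; under eq_bigr do rewrite coefNXn.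
have [sp|ip] := leqP (size p) i.
  rewrite [p`_i]nth_default // mulr0 big1 // => j _.
  by rewrite (gtn_eqF (leq_trans (ltn_ord j) sp)) !mulr0.
rewrite (bigD1 (Ordinal ip)) //= eqxx big1 => [|j jNi].
  by rewrite addr0 mulr1 mulrC.
by rewrite eq_sym -val_eqE /= in jNi; rewrite (negbTE jNi) !mulr0.
Qed.

(** * Orthogonal polynomials of a regular symmetric bilinear form *)

Section RegularForm.
Variables (R : realType) (B : {poly R[i]} -> {poly R[i]} -> R[i]).

(* The bound on [size q] makes [B] nondegenerate on the polynomials of each
   bounded degree. *)
Definition regular_form :=
  forall p : {poly R[i]}, p != 0 ->
    exists2 q : {poly R[i]}, (size q <= size p)%N & B p q != 0.

Hypotheses (Blin : forall r, scalar (B^~ r)) (Bsym : forall p q, B p q = B q p).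
Hypothesis Breg : regular_form.
Variables (P : nat -> {poly R[i]}) (PB : monic_orthogonal B P).

Lemma orthogonal_lower_degree (n : nat) (q : {poly R[i]}) :
  (size q <= n)%N -> B (P n) q = 0.
Proof.
have [monP ortho] := PB; apply: (scalar_span_eq0 _ monP) => [a p r|k kn].
  by rewrite ![B (P n) _]Bsym Blin.
by apply: ortho => nk; rewrite nk ltnn in kn.
Qed.

(** Otherwise [P n] would be orthogonal to P_0, ..., P_n, hence to every polynomial of size at most
    n + 1, which includes the witness of regularity for [P n]. *)
Lemma orthogonal_norm_neq0 (n : nat) : B (P n) (P n) != 0.
Proof.
apply/eqP => Bn0; have [monP ortho] := PB.
have [monPn sPn] := monP n; have [q] := Breg (monic_neq0 monPn).
rewrite sPn => sq /eqP; apply.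
apply: (scalar_span_eq0 _ monP _ sq) => [a p r|k kn].
  by rewrite ![B (P n) _]Bsym Blin.
have [->//|nk] := eqVneq k n.
by apply: ortho => kn'; rewrite kn' eqxx in nk.
Qed.

Lemma orthogonal_to_basis_eq0 (N : nat) (p : {poly R[i]}) :
  (size p <= N)%N -> (forall k, (k < N)%N -> B p (P k) = 0) -> p = 0.
Proof.
move=> sp Bp; have [monP _] := PB; apply/eqP/negPn/negP => p0.
have [q sq /eqP] := Breg p0; apply.
apply: (scalar_span_eq0 _ monP Bp (leq_trans sq sp)) => a r s.
by rewrite ![B p _]Bsym Blin.
Qed.

(** The difference P_n(-x) - (-1)^n P_n(x) has degree below n, since the leading terms cancel.
    Invariance of [B] under reflection makes it orthogonal to all P_k with k < n, so it is zero. *)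
Lemma orthogonal_parity (n : nat) :
  (forall p q, B (p \Po (- 'X)) (q \Po (- 'X)) = B p q) ->
  P n \Po (- 'X) = (-1) ^+ n *: P n.
Proof.
move=> Beven; have [monP _] := PB; have [/monicP monPn sPn] := monP n.
rewrite lead_coefE sPn /= in monPn.
have NXK (p : {poly R[i]}) : (p \Po (- 'X)) \Po (- 'X) = p.
  apply/polyP => i; rewrite !coef_comp_polyNX mulrA -exprMn mulrNN mulr1.
  by rewrite expr1n mul1r.
have sNX (p : {poly R[i]}) : (size (p \Po (- 'X)) <= size p)%N.
  by apply/leq_sizeP => i ip; rewrite coef_comp_polyNX nth_default // mulr0.
apply/eqP; rewrite -subr_eq0 addrC -scaleNr; apply/eqP.
have sD : (size (- (-1) ^+ n *: P n + (P n \Po (- 'X)))%R <= n)%N.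
  apply/leq_sizeP => i; rewrite leq_eqVlt coefD coefZ coef_comp_polyNX.
  case/orP => [/eqP <-|ni]; first by rewrite monPn !mulr1 addNr.
  by rewrite nth_default ?sPn // !mulr0 addr0.
apply: (orthogonal_to_basis_eq0 sD) => k kn; rewrite Blin.
have sk : size (P k) = k.+1 by have [] := monP k.
(* Writing [P k] as a double reflection lets the invariance of [B] move one reflection off [P n] and
   leave the other on [P k]. *)
rewrite orthogonal_lower_degree ?sk // mulr0 add0r -[P k]NXK Beven.
by rewrite orthogonal_lower_degree // (leq_trans (sNX _)) ?sk.
Qed.

End RegularForm.

(** * The Dunkl operator on coefficients *)

Section DunklOperator.
Variables (R : realType) (mu : R).
Implicit Types p q : {poly R[i]}.

Lemma dunkl_is_linear : linear (@dunkl R mu).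
Proof.
move=> a p q; rewrite /dunkl linearP /= linearP /=.
have -> : a *: p + q - (a *: (p \Po - 'X) + (q \Po - 'X)) =
          a *: (p - (p \Po - 'X)) + (q - (q \Po - 'X)).
  by rewrite scalerBr addrACA opprD.
by rewrite divpD divpZl !scalerDr addrACA !scalerA [a * _]mulrC.
Qed.

HB.instance Definition _ :=
  GRing.isLinear.Build R[i] {poly R[i]} {poly R[i]} _ (@dunkl R mu)
    dunkl_is_linear.

Lemma coef_dunkl p (i : nat) :
  (dunkl mu p)`_i = (dunkl_number mu i.+1)%:C * p`_i.+1.
Proof.
rewrite -{1}[p]coefK poly_def linear_sum coef_sum.
under eq_bigr => j _ do rewrite linearZ /= dunkl_Xn !coefZ coefXn.
have [sp|ip] := leqP (size p) i.+1.
  rewrite [p`_i.+1]nth_default // mulr0 big1 // => -[[|j] jp] _ /=.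
    (* The constant term could match the exponent 0, because [0.-1] is 0; it vanishes because mu_0 =
       0. *)
    by rewrite /dunkl_number expr0 subrr mulr0 addr0 mul0r mulr0.
  by rewrite gtn_eqF ?mulr0 // -ltnS (leq_trans jp).
rewrite (bigD1 (Ordinal ip)) //= eqxx big1 => [|[[|j] jp] jNi] /=.
- by rewrite addr0 mulr1 mulrC.
- by rewrite /dunkl_number expr0 subrr mulr0 addr0 mul0r mulr0.
by rewrite -val_eqE /= eqSS eq_sym in jNi; rewrite (negbTE jNi) !mulr0.
Qed.

Lemma size_dunkl p (n : nat) : (size p <= n.+1)%N -> (size (dunkl mu p) <= n)%N.
Proof.
move=> sp; apply/leq_sizeP => i ni.
by rewrite coef_dunkl nth_default ?mulr0 // (leq_trans sp).
Qed.

(** The numbers mu_n are real. This makes conj p a usable test polynomial for the Sobolev form. *)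
Lemma dunkl_conj p :
  dunkl mu (map_poly conjc p) = map_poly conjc (dunkl mu p).
Proof.
by apply/polyP => i; rewrite !(coef_dunkl, coef_map) /= rmorphM /= oppr0.
Qed.

(** Lowering the degree by one flips parity; the sign cancels in a product of two Dunkl
    derivatives. *)
Lemma dunkl_comp_polyNX p :
  dunkl mu (p \Po (- 'X)) = - (dunkl mu p \Po (- 'X)).
Proof.
apply/polyP => i; rewrite coefN !(coef_dunkl, coef_comp_polyNX) exprS.
by rewrite mulN1r mulNr mulrN mulrCA.
Qed.

End DunklOperator.

(** * The linear form of a measure: moments, parity and positivity *)

Section LinearForm.
Variables (R : realType) (u : {measure set (measurableTypeR R) -> \bar R}).
Hypothesis uP : admissible_measure u.
Implicit Types f p q : {poly R[i]}.

Lemma integrable_poly (p : {poly R}) :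
  u.-integrable setT (fun x : measurableTypeR R => p.[(x : R)]%:E).
Proof.
have [_ um _] := uP.
rewrite (_ : (fun _ => _) =
    fun x => (\sum_(i < size p) ((p`_i)%:E * ((x : R) ^+ i)%:E))%E); last first.
  by apply/funext => x; rewrite horner_coef -sumEFin.
by apply: integrable_sum => // i _; apply: integrableZl.
Qed.

Lemma Rintegral_poly (p : {poly R}) (N : nat) : (size p <= N)%N ->
  \int[u]_(x in setT) p.[(x : R)] = \sum_(i < N) p`_i * moment u i.
Proof.
have [_ um _] := uP.
elim: N p => [|N IHN] p sp.
  have -> : p = 0 by apply/eqP; rewrite -size_poly_eq0 -leqn0.
  rewrite big_ord0; transitivity (\int[u]_(x in setT) (0 * (x : R) ^+ 0)).
    by apply: eq_Rintegral => x _; rewrite mul0r horner0.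
  by rewrite RintegralZl ?mul0r //; exact: (um 0%N).
rewrite big_ord_recr /=.
have pE : p = take_poly N p + p`_N *: 'X^N.
  apply/polyP => i; rewrite coefD coefZ coefXn coef_take_poly.
  case: ltngtP => [iN|iN|->]; rewrite ?mulr0 ?mulr1 ?addr0 ?add0r //.
  by rewrite nth_default // (leq_trans sp).
transitivity (\int[u]_(x in setT)
    ((take_poly N p).[(x : R)] + p`_N * (x : R) ^+ N)).
  by apply: eq_Rintegral => x _; rewrite [in LHS]pE hornerD hornerZ hornerXn.
rewrite RintegralD //; first last.
- by apply: (integrableZl _ _ (um N)).
- exact: integrable_poly.
rewrite RintegralZl //; last exact: um.
rewrite (IHN _ (size_take_poly _ _)); congr (_ + _).
by apply: eq_bigr => i _; rewrite coef_take_poly ltn_ord.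
Qed.

(** Moments are real, so real and imaginary parts of the coefficients separate. The free bound [N]
    allows several polynomials to be expanded over one index range, which reduces linearity and
    parity to finite sums. *)
Lemma lform_moment f (N : nat) : (size f <= N)%N ->
  lform u f = \sum_(i < N) f`_i * (moment u i)%:C.
Proof.
move=> sf; rewrite /lform.
have ReE (x : R) : complex.Re f.[x%:C] =
    (\poly_(i < N) complex.Re f`_i).[x].
  rewrite (horner_coef_wide _ sf) horner_poly (raddf_sum (@complex.Re R)).
  apply: eq_bigr => i _; rewrite -rmorphXn.
  by case: f`_i => a b /=; rewrite mulr0 subr0.
have ImE (x : R) : complex.Im f.[x%:C] =
    (\poly_(i < N) complex.Im f`_i).[x].
  rewrite (horner_coef_wide _ sf) horner_poly (raddf_sum (@complex.Im R)).
  apply: eq_bigr => i _; rewrite -rmorphXn.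
  by case: f`_i => a b /=; rewrite mulr0 add0r.
under [X in X +i* _]eq_Rintegral do rewrite ReE.
under [X in _ +i* X]eq_Rintegral do rewrite ImE.
rewrite !(Rintegral_poly (size_poly _ _)).
apply/eqP; rewrite eq_complex raddf_sum (raddf_sum (@complex.Im R)) /=.
apply/andP; split; apply/eqP; apply: eq_bigr => i _;
  rewrite coef_poly ltn_ord; case: f`_i => a b /=.
  by rewrite mulr0 subr0.
by rewrite mulr0 add0r.
Qed.

Lemma lform_is_scalar : scalar (lform u).
Proof.
move=> a p q; set N := maxn (size p) (size q).
have sp : (size p <= N)%N by exact: leq_maxl.
have sq : (size q <= N)%N by exact: leq_maxr.
have spq : (size (a *: p + q)%R <= N)%N.
  rewrite (leq_trans (size_polyD _ _)) // geq_max sq andbT.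
  exact: leq_trans (size_scale_leq _ _) sp.
rewrite !(lform_moment (N := N)) // mulr_sumr -big_split.
by apply: eq_bigr => i _; rewrite coefD coefZ mulrDl mulrA.
Qed.

Lemma lformZ a p : lform u (a *: p) = a * lform u p.
Proof.
by rewrite -[a *: p]addr0 lform_is_scalar [lform u 0](@lform_moment _ 0)
  ?size_poly0 // big_ord0 addr0.
Qed.

Lemma lform_comp_polyNX f :
  (forall n, moment u n.*2.+1 = 0) -> lform u (f \Po (- 'X)) = lform u f.
Proof.
move=> uodd; rewrite !(lform_moment (N := size f)) //; last first.
  by apply/leq_sizeP => i fi; rewrite coef_comp_polyNX nth_default ?mulr0.
apply: eq_bigr => i _; rewrite coef_comp_polyNX -signr_odd.
have [io|_] := boolP (odd i); last by rewrite mul1r.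
by rewrite -[i : nat]odd_double_half io add1n uodd !mulr0.
Qed.

(** At a real point conjugation commutes with evaluation, so the integrand is |p(x)|^2. *)
Lemma lform_mulJ_ge0 p : 0 <= lform u (p * map_poly conjc p).
Proof.
have [_ um _] := uP; have J (x : R) : 0 <= (p * map_poly conjc p).[x%:C].
  by rewrite hornerM -[in X in _ * X](conjc_real x) horner_map mulcJ_ge0.
rewrite lecE /=; apply/andP; split.
  apply/eqP; transitivity (\int[u]_(x in setT) (0 * (x : R) ^+ 0)).
    apply: eq_Rintegral => x _.
    by have := J x; rewrite lecE mul0r => /andP[/eqP -> _].
  by rewrite RintegralZl ?mul0r //; exact: (um 0%N).
by apply: Rintegral_ge0 => x _; have := J x; rewrite lecE => /andP[].
Qed.

(* [p * conj p] is positive on a neighbourhood of any point of the support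
   that is not a root of [p]. *)
Lemma lform_mulJ_neq0 p : p != 0 -> lform u (p * map_poly conjc p) != 0.
Proof.
move=> p0; have [_ _ uinf] := uP.
set f := p * map_poly conjc p.
(* A real polynomial equal to |p|^2 on the real line, so that continuity and integrability are
   available. *)
set q := \poly_(i < size f) complex.Re f`_i.
have qE (x : R) : complex.Re f.[x%:C] = q.[x].
  rewrite horner_coef horner_poly (raddf_sum (@complex.Re R)).
  apply: eq_bigr => i _; rewrite -rmorphXn.
  by case: f`_i => a b /=; rewrite mulr0 subr0.
have fE (x : R) : f.[x%:C] = p.[x%:C] * p.[x%:C]^*.
  by rewrite hornerM -[in X in _ * X](conjc_real x) horner_map.
have q_ge0 (x : R) : 0 <= q.[x].
  by have := mulcJ_ge0 p.[x%:C]; rewrite -fE lecE qE => /andP[].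
have q_eq0 (x : R) : q.[x] = 0 -> p.[x%:C] = 0.
  move=> qx; apply/eqP; have : f.[x%:C] = 0.
    have := mulcJ_ge0 p.[x%:C]; rewrite -fE lecE => /andP[/eqP im _].
    by apply/eqP; rewrite eq_complex im qE qx !eqxx.
  by rewrite fE => /eqP; rewrite mulf_eq0 conjc_eq0 orbb.
(* The support is infinite, while [p] has finitely many roots. *)
have [x ux px] : exists2 x, msupport u x & p.[x%:C] != 0.
  apply/not_exists2P => nroot; apply: uinf.
  have rfin : finite_set [set x : R | root p x%:C].
    have [r pE] := closed_field_poly_normal p.
    have -> : [set x : R | root p x%:C] = real_complex R @^-1` [set` r].
      apply/seteqP; split => x /=;
        by rewrite pE rootZ ?lead_coef_eq0 // root_prod_XsubC.
    apply: finite_preimage (finite_seq r).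
    by move=> y z _ _ [].
  apply: sub_finite_set rfin => x ux /=; apply/negPn/negP => px.
  by have [] := nroot x.
pose U := [set y : R | 0 < q.[y]].
have oU : open U.
  apply: (open_comp (f := horner q) (D := [set y | 0 < y])).
    by move=> y _; exact: continuous_horner.
  exact: open_gt.
have Ux : U x.
  rewrite /U /= lt_neqAle q_ge0 andbT eq_sym.
  by apply: contra px => /eqP/q_eq0 ->.
have iq := integrable_poly q.
apply/eqP => /(congr1 (@complex.Re R)) /=.
under eq_Rintegral do rewrite qE.
move=> q_int0; have abs_q_int0 :
    (\int[u]_(x in setT) `|q.[(x : R)]%:E| = 0)%E.
  under eq_integral => y _ do rewrite gee0_abs ?lee_fin //.
  by rewrite -[LHS]fineK ?[fine _]q_int0 // integrable_fin_num.
have /(ae_eq_integral_abs u measurableT (measurable_int _ iq)) := abs_q_int0.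
move=> [N [mN N0 UN]].
have := ux U oU Ux.
(* A nonnegative [q] with zero integral vanishes off a null set; [U] lies in that set, although it
   is an open neighbourhood of a support point. *)
suff -> : u U = 0%E by rewrite ltxx.
apply: (subset_measure0 _ mN _ N0).
  exact: measurable_realfun.open_measurable.
move=> y Uy; apply: UN => /= /(_ I) [qy0].
by move: Uy; rewrite /U /= qy0 ltxx.
Qed.

Lemma lform_mul_linear a p q r :
  lform u ((a *: p + q) * r) = a * lform u (p * r) + lform u (q * r).
Proof. by rewrite mulrDl -scalerAl lform_is_scalar. Qed.

Lemma regular_lform : regular_form (fun p q => lform u (p * q)).
Proof.
move=> p p0; exists (map_poly conjc p); first by rewrite size_map_poly.
exact: lform_mulJ_neq0.
Qed.

Lemma mops_lower_degree P (n : nat) q :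
  mops u P -> (size q <= n)%N -> lform u (P n * q) = 0.
Proof.
move=> PU; apply: orthogonal_lower_degree PU _ _ => [r|p r].
  by move=> a p s; exact: lform_mul_linear.
by rewrite mulrC.
Qed.

Lemma mops_parity P (n : nat) :
  (forall k, moment u k.*2.+1 = 0) -> mops u P ->
  P n \Po (- 'X) = (-1) ^+ n *: P n.
Proof.
move=> uodd PU; apply: orthogonal_parity PU _ _ => [r|p q||p q].
- by move=> a p s; exact: lform_mul_linear.
- by rewrite mulrC.
- exact: regular_lform.
by rewrite -comp_polyM lform_comp_polyNX.
Qed.

End LinearForm.

(** * The Dunkl-Sobolev form *)

Section Sobolev.
Variables (R : realType) (mu lambda : R).
Variables (u v : {measure set (measurableTypeR R) -> \bar R}).
Hypotheses (uP : admissible_measure u) (vP : admissible_measure v).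

Local Notation B := (dunkl_sobolev mu lambda u v).

Lemma dunkl_sobolev_sym p q : B p q = B q p.
Proof. by rewrite /dunkl_sobolev mulrC [dunkl mu p * _]mulrC. Qed.

Lemma dunkl_sobolev_linear r : scalar (B^~ r).
Proof.
move=> a p q /=; rewrite /dunkl_sobolev linearP !lform_mul_linear //.
by rewrite [_ * (_ + _)]mulrDr [a * (_ + _)]mulrDr addrACA mulrCA.
Qed.

(** Against conj p the [u] part is strictly positive and the [v] part is nonnegative. *)
Lemma regular_dunkl_sobolev : 0 <= lambda -> regular_form B.
Proof.
move=> lambda_ge0 p p0; exists (map_poly conjc p).
  by rewrite size_map_poly.
rewrite /dunkl_sobolev dunkl_conj gt_eqF // ltr_wpDr //.
  by rewrite mulr_ge0 ?lform_mulJ_ge0 // lecR.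
by rewrite lt_def lform_mulJ_neq0 ?lform_mulJ_ge0.
Qed.

Lemma dunkl_sobolev_comp_polyNX p q :
  (forall n, moment u n.*2.+1 = 0) -> (forall n, moment v n.*2.+1 = 0) ->
  B (p \Po (- 'X)) (q \Po (- 'X)) = B p q.
Proof.
move=> u_odd v_odd; rewrite /dunkl_sobolev !dunkl_comp_polyNX mulrNN.
by rewrite -!comp_polyM !lform_comp_polyNX.
Qed.

End Sobolev.

(** * Nonvanishing of the Dunkl numbers, and the two identities *)

Lemma dunkl_number_neq0 (R : realType) (mu : R) (n : nat) :
  (forall k : nat, mu <> - k%:R - 1 / 2) -> dunkl_number mu n.+1 != 0.
Proof.
move=> hmu; rewrite /dunkl_number -signr_odd.
have [nodd|neven] := boolP (odd n.+1); last first.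
  by rewrite expr0 subrr mulr0 addr0 pnatr_eq0.
(* Here n is even and mu_{n+1} = n + 1 + 2 mu, which vanishes only for mu = -n/2 - 1/2. *)
apply/eqP => mun0; apply: (hmu n./2).
have nE : n.+1%:R = 1 + n./2%:R * 2 :> R.
  have neven : odd n = false by apply/negbTE.
  by rewrite -natr1 addrC -{1}(odd_double_half n) neven add0n -muln2 natrM.
rewrite nE expr1 in mun0; lra.
Qed.

Theorem theorem4p1 (R : realType) (mu : R)
  (hmu : forall n : nat, mu <> - n%:R - 1 / 2)
  (u v : {measure set (measurableTypeR R) -> \bar R})
  (P Q : nat -> {poly R[i]}) (sigma : nat -> R[i])
  (huv : dunkl_coherent_pair mu u v P Q sigma)
  (epsilon : nat -> R[i])
  (hepsilon : forall n : nat, epsilon n = - sigma n.+1)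
  (lambda : R) (hlambda : 0 < lambda)
  (S : nat -> {poly R[i]})
  (hS : monic_orthogonal (dunkl_sobolev mu lambda u v) S)
  (a eta : nat -> R[i])
  (ha : forall n : nat, (2 <= n)%N ->
    a (n - 2)%N = (dunkl_number mu n.+1)%:C / (dunkl_number mu n.-1)%:C
                  * epsilon (n - 2)%N)
  (heta : forall n : nat, (2 <= n)%N ->
    eta (n - 2)%N = lform u (P n.-1 ^+ 2)
                    / dunkl_sobolev mu lambda u v (S n.-1) (S n.-1)
                    * a (n - 2)%N)
  (n : nat) (hn : (2 <= n)%N) :
  P n.+1 + a (n - 2)%N *: P n.-1 = S n.+1 + eta (n - 2)%N *: S n.-1
  /\ (dunkl_number mu n.+1)%:C *: Q n
     = dunkl mu (S n.+1) + eta (n - 2)%N *: dunkl mu (S n.-1).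
Proof.
have [[[uP _ u_odd] hP] [[vP _ v_odd] hQ] _ hQP] := huv.
set B := dunkl_sobolev mu lambda u v in hS heta *.
have lambda_ge0 := ltW hlambda.
have Blin : forall r, scalar (B^~ r) by exact: dunkl_sobolev_linear.
have Bsym : forall p q, B p q = B q p by exact: dunkl_sobolev_sym.
have Breg : regular_form B by exact: regular_dunkl_sobolev.
have Bpar p q : B (p \Po (- 'X)) (q \Po (- 'X)) = B p q.
  exact: dunkl_sobolev_comp_polyNX.
have [monP _] := hP; have [monS _] := hS.
have sP k : size (P k) = k.+1 by have [] := monP k.
have sS k : size (S k) = k.+1 by have [] := monS k.
set an := a _; set en := eta _.
have dF : dunkl mu (P n.+1 + an *: P n.-1) = (dunkl_number mu n.+1)%:C *: Q n.
  rewrite hQP // linearD linearZ /= scalerBr !scalerA divff ?scale1r; last first.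
    by rewrite fmorph_eq0 dunkl_number_neq0.
  congr (_ + _); rewrite -scaleNr /an ha // hepsilon; congr (_ *: _).
  (* Since n >= 2, the index shift in epsilon_{n-2} lands on the coherence coefficient
     sigma_{n-1}. *)
  have -> : (n - 2).+1 = n.-1 by lia.
  by rewrite mulrN mulrAC.
have sobolevF k : (k <= n)%N ->
    B (P n.+1 + an *: P n.-1) (S k) = an * lform u (P n.-1 * S k).
  move=> kn; rewrite /B /dunkl_sobolev dF -scalerAl lformZ //.
  rewrite (mops_lower_degree vP hQ); last first.
    by apply: size_dunkl; rewrite sS.
  rewrite !mulr0 addr0 addrC lform_mul_linear //.
  rewrite (mops_lower_degree (n := n.+1) uP hP).
    by rewrite addr0.
  by rewrite sS.
have first_identity :
    P n.+1 + an *: P n.-1 = S n.+1 + en *: S n.-1.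
  apply/eqP; rewrite -subr_eq0; apply/eqP.
  apply: (orthogonal_to_basis_eq0 Blin Bsym Breg hS (N := n.+1)).
    rewrite opprD addrACA; apply: leq_trans (size_polyD _ _) _.
    rewrite geq_max (size_monicB (monP _) (monS _)) /=.
    have sPS (T : nat -> {poly R[i]}) c :
        (forall j, size (T j) = j.+1) -> (size (c *: T n.-1) <= n.+1)%N.
      by move=> sT; rewrite (leq_trans (size_scale_leq _ _)) // sT; lia.
    by rewrite (leq_trans (size_polyD _ _)) // geq_max size_polyN !sPS.
  move=> k; rewrite ltnS => kn.
  rewrite -scaleN1r addrC Blin sobolevF // [S n.+1 + _]addrC Blin.
  have [_ orthoS] := hS.
  rewrite [B (S n.+1) _]orthoS ?addr0; last by move=> nk; rewrite -nk ltnn in kn.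
  have [->|nk] := eqVneq k n.-1.
    (* Both factors are monic of degree n - 1, so replacing [S n.-1] by [P n.-1] changes the product
       by a term that [P n.-1] annihilates. *)
    have SP : lform u (P n.-1 * S n.-1) = lform u (P n.-1 ^+ 2).
      have -> : P n.-1 * S n.-1 =
          1 *: P n.-1 ^+ 2 + P n.-1 * (S n.-1 - P n.-1).
        by rewrite scale1r expr2 -mulrDr addrC subrK.
      rewrite lform_is_scalar // mul1r mops_lower_degree ?addr0 //.
      exact: size_monicB (monS _) (monP _).
    rewrite SP /en heta // -/an mulrAC divfK ?orthogonal_norm_neq0 //.
    by rewrite mulN1r mulrC addNr.
  rewrite [B _ (S k)]orthoS; last by move/eqP; rewrite eq_sym (negbTE nk).
  suff -> : lform u (P n.-1 * S k) = 0 by rewrite !mulr0 addr0.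
  move: kn; rewrite leq_eqVlt => /orP[/eqP kE|kn].
    (* For k = n the product has parity (n - 1) + n, which is odd, whereas the form is invariant
       under reflection. *)
    have : lform u ((P n.-1 * S k) \Po (- 'X)) = - lform u (P n.-1 * S k).
      rewrite comp_polyM (mops_parity uP) //.
      rewrite (orthogonal_parity Blin Bsym Breg hS) // kE.
      rewrite -scalerAl -scalerAr scalerA -exprD lformZ //.
      have -> : (n.-1 + n)%N = (n.-1).*2.+1 by lia.
      by rewrite -signr_odd /= odd_double mulN1r.
    rewrite lform_comp_polyNX // => /eqP.
    by rewrite -addr_eq0 -mulr2n mulrn_eq0 => /eqP.
  (* What remains is k < n - 1, where [S k] has degree below that of [P n.-1]. *)
  rewrite mops_lower_degree // sS.
  by move: kn nk; lia.
split=> //.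
by rewrite -dF first_identity linearD linearZ.
Qed.
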